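(* Whenever $k,m$ are integers with $0\le k\le m$ and $m\ge1$ we have $$L_{k,m}^{Q}=(\mathbb{S}_{k,m})^{Q}\qquad\text{and}\qquad L_{k,m}^{P}=(\mathbb{S}_{k,m})^{P}.$$
   Context: $\mathbb{C}P^N(\sqrt2)$ is $\mathbb{C}P^N$ with the symplectic form obtained by coisotropic reduction of the sphere of radius $\sqrt2$ in $\mathbb{C}^{N+1}$; homogeneous coordinates are normalized by $\sum|z_j|^2=2$. $Q_N(\sqrt2)=\{[z_0:\cdots:z_N]:\sum z_j^2=0\}\subset\mathbb{C}P^N(\sqrt2)$ with the restricted form. A Lagrangian $L\subset(M,\omega)$ is monotone if there is $\lambda>0$ such that the area and Maslov homomorphisms on $\pi_2(M,L)$ satisfy $I_\omega=\lambda I_\mu$. Throughout $n=k+m+1$, and $S^0=\{\pm1\}$. $T^*S^n=\{(p,q)\in\mathbb{R}^{n+1}\times\mathbb{R}^{n+1}:p\cdot q=0,|q|=1\}$ with form $d(\sum p_jdq_j)$; $T^*\mathbb{R}P^n=T^*S^n/((p,q)\sim(-p,-q))$; $D_1^*$ denotes $|p|<1$. For $r>0$, $\mathcal{P}_{k,m}^r\subset T^*S^{k+m+1}$ is the image of $S^1\times S^k\times S^m\ni(e^{i\theta},x,y)\mapsto\big((-r\sin\theta\,x,\ r\cos\theta\,y),(\cos\theta\,x,\ \sin\theta\,y)\big)$, where $S^k\subset\mathbb{R}^{k+1}$, $S^m\subset\mathbb{R}^{m+1}$, and $\underline{\mathcal{P}}_{k,m}^r$ is its image in $T^*\mathbb{R}P^{k+m+1}$.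 Define $\Psi\colon D_1^*S^{k+m+1}\to Q_{k+m+2}(\sqrt2)$ by $\Psi(p,q)=[\sqrt{1-|p|^2}:p+iq]$, and $\Psi^P\colon D_1^*\mathbb{R}P^{k+m+1}\to\mathbb{C}P^{k+m+1}(\sqrt2)$ by $\Psi^P([(p,q)])=\left[\sqrt{f(|p|)}\,p+\frac{i}{\sqrt{f(|p|)}}q\right]$ with $f(x)=\frac{1-\sqrt{1-x^2}}{x^2}$, $f(0)=\frac12$. Both are symplectomorphisms onto their images. Set $$L_{k,m}^Q=\Psi\left(\mathcal{P}_{k,m}^{1-\frac{1}{k+m+1}}\right),\qquad L_{k,m}^P=\Psi^P\left(\underline{\mathcal{P}}_{k,m}^{1-\frac{2}{k+m+2}}\right).$$ $\mathbb{S}_{k,m}=\{[ix:y]\in\mathbb{C}P^n(\sqrt2): x\in S^k\subset\mathbb{R}^{k+1},\ y\in S^m\subset\mathbb{R}^{m+1}\}\subset Q_n(\sqrt2)$. Biran circle bundle constructions. Let $P_Q=\{w=u+iv\in\mathbb{C}^{n+1}: u,v\in\mathbb{R}^{n+1},\ |u|=|v|=1,\ u\cdot v=0\}$, with projection $w\mapsto[w]\in Q_n(\sqrt2)$. (Q) Let $\mathcal{D}_{2\pi}^n(P_Q)=\{(w,\zeta): w\in P_Q,\ \zeta\in\mathbb{C},\ |\zeta|<\sqrt2\}/\big((e^{-i\theta}w,\zeta)\sim(w,e^{i\theta}\zeta)\big)$, a disk bundle over $Q_n(\sqrt2)$, embedded in $Q_{n+1}(\sqrt2)$ by $\Theta_Q([w,\zeta])=\left[\sqrt{1-\frac{|\zeta|^2}{4}}\,\zeta:\left(1-\frac{|\zeta|^2}{4}\right)w-\frac{\zeta^2\bar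 w}{4}\right]$. Then $(\mathbb{S}_{k,m})^Q$ is the set of $\Theta_Q([w,\zeta])$ with $[w]\in\mathbb{S}_{k,m}$ and $|\zeta|=\rho$, where $\rho\in(0,\sqrt2)$ is the unique radius for which this is a monotone Lagrangian submanifold of $Q_{n+1}(\sqrt2)$; this radius is $\rho=\sqrt{2/(k+m+1)}$. (P) Let $P_P=P_Q/(w\sim-w)$ and $\mathcal{D}_\pi^n(P_P)=\{([w],\zeta):[w]\in P_P,\ |\zeta|<1\}/\big(([e^{i\theta/2}w],e^{i\theta}\zeta)\sim([w],\zeta)\big)$, a disk bundle over $Q_n(\sqrt2)$, embedded in $\mathbb{C}P^n(\sqrt2)$ by $\Theta_P([([w],\zeta)])=\left[\sqrt{1-|\zeta|^2/2}\,w-\zeta\bar w/\sqrt2\right]$. Then $(\mathbb{S}_{k,m})^P$ is the set of $\Theta_P([([w],\zeta)])$ with $w$ lying over $\mathbb{S}_{k,m}$ and $|\zeta|=\rho$, where $\rho\in(0,1)$ is the unique radius for which this is a monotone Lagrangian submanifold of $\mathbb{C}P^n(\sqrt2)$; this radius is $\rho=\sqrt{2/(k+m+2)}$. *)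

(* Defs.v *)
From HB Require Import structures.
From mathcomp Require Import all_boot all_order all_algebra.
From mathcomp Require Import complex generic_quotient.
From mathcomp Require Import ring.
From mathcomp Require Import boolp classical_sets reals trigo.

Set Implicit Arguments.
Unset Strict Implicit.
Unset Printing Implicit Defensive.

Import Order.TTheory GRing.Theory Num.Theory.
Import ComplexField.Normc.

Local Open Scope classical_set_scope.
Local Open Scope ring_scope.
Local Open Scope complex_scope.
Local Open Scope quotient_scope.

(** * Euclidean and complex vectors *)

(* Over R[i] this is the complex bilinear form, so [dot z z = \sum_j z_j ^+ 2]. *)
Definition dot (K : pzRingType) (n : nat) (u v : 'rV[K]_n) : K :=
  \sum_j u 0 j * v 0 j.

(* The library norm `|x| on matrices is the sup norm. *)
Definition enorm (R : realType) (n : nat) (x : 'rV[R]_n) : R :=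
  Num.sqrt (dot x x).

Lemma enormN (R : realType) (n : nat) (x : 'rV[R]_n) : enorm (- x) = enorm x.
Proof.
by rewrite /enorm; congr Num.sqrt; apply: eq_bigr => j _; rewrite !mxE mulrNN.
Qed.

Definition unit_sphere (R : realType) (n : nat) : set 'rV[R]_n.+1 :=
  [set x | enorm x = 1].
Arguments unit_sphere : clear implicits.

(* [cvec p q] is the vector p + iq. *)
Definition cvec (R : realType) (n : nat) (p q : 'rV[R]_n) : 'rV[R[i]]_n :=
  \row_j (p 0 j +i* q 0 j).

Definition conjv (R : realType) (n : nat) (w : 'rV[R[i]]_n) : 'rV[R[i]]_n :=
  map_mx conjc w.

Lemma dot_cvec (R : realType) (n : nat) (p q : 'rV[R]_n) :
  dot (cvec p q) (cvec p q) = (dot p p - dot q q) +i* (dot p q *+ 2).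
Proof.
rewrite /dot -sumrB -sumrMnl.
elim/big_rec3: _ => [//|j a b c _ ->]; rewrite !mxE.
by apply/eqP; rewrite eq_complex /=; apply/andP; split; apply/eqP; ring.
Qed.

Lemma dot_row_mx (K : pzRingType) (n1 n2 : nat) (u u' : 'rV[K]_n1)
    (v v' : 'rV[K]_n2) :
  dot (row_mx u v) (row_mx u' v') = dot u u' + dot v v'.
Proof.
by rewrite /dot big_split_ord; congr (_ + _); apply: eq_bigr => j _;
  rewrite ?row_mxEl ?row_mxEr.
Qed.

Lemma dot_ge0 (R : realType) (n : nat) (x : 'rV[R]_n) : 0 <= dot x x.
Proof. by apply: sumr_ge0 => j _; rewrite -expr2 sqr_ge0. Qed.

Lemma enorm_sqr (R : realType) (n : nat) (x : 'rV[R]_n) :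
  enorm x ^+ 2 = dot x x.
Proof. by rewrite sqr_sqrtr ?dot_ge0. Qed.

Lemma cvec_neq0 (R : realType) (n : nat) (p q : 'rV[R]_n) :
  enorm q = 1 -> cvec p q != 0.
Proof.
move=> q1; apply/eqP => /matrixP z0.
have q0 : q = 0 by apply/rowP => j; have := z0 0 j; rewrite !mxE => -[].
move: q1; rewrite q0 /enorm /dot big1 ?sqrtr0 => [/eqP|j _].
  by rewrite eq_sym oner_eq0.
by rewrite mxE mul0r.
Qed.

Definition expi (R : realType) (t : R) : R[i] := cos t +i* sin t.

(** * Projective space and the quadric *)

(* A point of CP^N is a complex line in C^(N+1); the normalization
   \sum_j |z_j|^2 = 2 of homogeneous coordinates only selects representatives. *)
Definition CP (R : realType) (N : nat) : Type :=
  {L : {vspace 'rV[R[i]]_N.+1} | \dim L == 1%N}.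

Lemma dim_line (R : realType) (N : nat) :
  \dim <[const_mx 1 : 'rV[R[i]]_N.+1]>%VS == 1%N.
Proof.
rewrite dim_vline eqb1; apply/eqP => /matrixP /(_ 0 0).
by rewrite !mxE; apply/eqP; rewrite oner_eq0.
Qed.

(* [hcoord z] is [z_0 : ... : z_N] for z != 0 (and a dummy point for z = 0). *)
Definition hcoord (R : realType) (N : nat) (z : 'rV[R[i]]_N.+1) : CP R N :=
  insubd (exist (fun L : {vspace _} => \dim L == 1%N) _ (dim_line R N))
    <[z]>%VS.

Lemma hcoord_scale (R : realType) (N : nat) (c : R[i]) (z : 'rV[R[i]]_N.+1) :
  c != 0 -> hcoord (c *: z) = hcoord z.
Proof.
move=> c0; congr insubd; apply/eqP; rewrite eqEsubv -!memvE.
rewrite memvZ ?memv_line //= -[z in z \in _](scalerK c0).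
by rewrite memvZ ?memv_line.
Qed.

Definition quadric (R : realType) (N : nat) : set (CP R N) :=
  [set hcoord z | z in [set z | z != 0 /\ dot z z = 0]].
Arguments quadric : clear implicits.

(** * Quotients by a sign *)

Definition pm_rel (V : zmodType) : rel V := fun x y => (x == y) || (x == - y).

Lemma pm_refl (V : zmodType) : reflexive (@pm_rel V).
Proof. by move=> x; rewrite /pm_rel eqxx. Qed.

Lemma pm_sym (V : zmodType) : symmetric (@pm_rel V).
Proof.
by move=> x y; rewrite /pm_rel [x == y]eq_sym -eqr_oppLR [- x == y]eq_sym.
Qed.

Lemma pm_trans (V : zmodType) : transitive (@pm_rel V).
Proof.
move=> y x z /orP[] /eqP-> // /orP[] /eqP->; rewrite /pm_rel ?opprK eqxx ?orbT //.
Qed.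

Canonical pm_equiv (V : zmodType) :=
  EquivRel (@pm_rel V) (@pm_refl V) (@pm_sym V) (@pm_trans V).

Notation pm_quot V := {eq_quot (pm_equiv V)}.

(** * Cotangent bundles of spheres and real projective spaces *)

(* The ambient space of T^*S^n; covectors come first, as in (p, q). *)
Notation phase R n := ('rV[R]_n.+1 * 'rV[R]_n.+1)%type.

Definition TS (R : realType) (n : nat) : set (phase R n) :=
  [set pq | dot pq.1 pq.2 = 0 /\ enorm pq.2 = 1].
Arguments TS : clear implicits.

Definition D1S (R : realType) (n : nat) : set (phase R n) :=
  [set pq | TS R n pq /\ enorm pq.1 < 1].
Arguments D1S : clear implicits.

(* T^*RP^n is the image of T^*S^n in the quotient of the ambient space by
   (p, q) ~ (-p, -q). *)
Definition D1RP (R : realType) (n : nat) : set (pm_quot (phase R n)) :=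
  [set \pi_(pm_quot (phase R n)) pq | pq in D1S R n].
Arguments D1RP : clear implicits.

(* Here n = k + m + 1 is written k + m.+1, so that n.+1 is k.+1 + m.+1. *)
Definition torusS (R : realType) (k m : nat) (r : R) :
    set (phase R (k + m.+1)) :=
  [set pq | exists (t : R) (x : 'rV[R]_k.+1) (y : 'rV[R]_m.+1),
    [/\ unit_sphere R k x, unit_sphere R m y &
        pq = (row_mx (- (r * sin t) *: x) ((r * cos t) *: y),
              row_mx (cos t *: x) (sin t *: y))]].
Arguments torusS : clear implicits.

Definition torusRP (R : realType) (k m : nat) (r : R) :
    set (pm_quot (phase R (k + m.+1))) :=
  [set \pi_(pm_quot (phase R (k + m.+1))) pq | pq in torusS R k m r].
Arguments torusRP : clear implicits.

(** * The embeddings Psi and Psi^P *)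

Definition Psi (R : realType) (n : nat) (pq : phase R n) : CP R n.+1 :=
  hcoord (row_mx (const_mx (Num.sqrt (1 - enorm pq.1 ^+ 2))%:C : 'rV_1)
                 (cvec pq.1 pq.2)).

Lemma Psi_quadric (R : realType) (n : nat) (pq : phase R n) :
  D1S R n pq -> quadric R n.+1 (Psi pq).
Proof.
case: pq => p q [[/= pq0 q1] p1]; eexists; last by [].
split.
  apply/eqP => /(congr1 (@rsubmx _ 1 1 n.+1)); rewrite row_mxKr linear0.
  by apply/eqP; exact: cvec_neq0.
rewrite (@dot_row_mx _ 1 n.+1) dot_cvec pq0 -!enorm_sqr q1 expr1n mul0rn.
rewrite /dot big_ord1 !mxE -rmorphM -expr2 sqr_sqrtr; last first.
  by rewrite subr_ge0 expr_le1 ?sqrtr_ge0 // ltW.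
by apply/eqP; rewrite eq_complex /= addr0 eqxx andbT; apply/eqP; ring.
Qed.

Definition fP (R : realType) (x : R) : R :=
  if x == 0 then 2^-1 else (1 - Num.sqrt (1 - x ^+ 2)) / x ^+ 2.

Definition PsiP_lift (R : realType) (n : nat) (pq : phase R n) : CP R n :=
  let s := Num.sqrt (fP (enorm pq.1)) in hcoord (cvec (s *: pq.1) (s^-1 *: pq.2)).

Definition PsiP (R : realType) (n : nat) (x : pm_quot (phase R n)) : CP R n :=
  PsiP_lift (repr x).

Lemma pm_repr (V : zmodType) (x : V) :
  repr (\pi_(pm_quot V) x) = x \/ repr (\pi_(pm_quot V) x) = - x.
Proof.
have : repr (\pi_(pm_quot V) x) = x %[mod pm_quot V] by rewrite reprK.
by move=> /eqmodP /orP[] /eqP; [left | right].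
Qed.

Lemma PsiP_pi (R : realType) (n : nat) (pq : phase R n) :
  PsiP (\pi_(pm_quot (phase R n)) pq) = PsiP_lift pq.
Proof.
rewrite /PsiP; have [-> //|->] := pm_repr pq.
rewrite /PsiP_lift /= enormN; set s := Num.sqrt _.
rewrite -[RHS](@hcoord_scale _ _ (-1)) ?oppr_eq0 ?oner_eq0 //.
congr hcoord; apply/rowP => j; rewrite !mxE !mulrN mulN1r.
by apply/eqP; rewrite eq_complex /= !eqxx.
Qed.

(* Psi and Psi^P have domains the unit disk bundles, whence the intersections. *)
Definition LQ (R : realType) (k m : nat) : set (CP R (k + m.+1).+1) :=
  [set Psi pq | pq in D1S R (k + m.+1)
                      `&` torusS R k m (1 - 1 / (k + m + 1)%:R)].
Arguments LQ : clear implicits.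

Definition LP (R : realType) (k m : nat) : set (CP R (k + m.+1)) :=
  [set PsiP x | x in D1RP R (k + m.+1)
                     `&` torusRP R k m (1 - 2 / (k + m + 2)%:R)].
Arguments LP : clear implicits.

(** * The Lagrangian S_{k,m} of the quadric *)

Definition Skm (R : realType) (k m : nat) : set (CP R (k + m.+1)) :=
  [set z | exists (x : 'rV[R]_k.+1) (y : 'rV[R]_m.+1),
    [/\ unit_sphere R k x, unit_sphere R m y &
        z = hcoord (row_mx (cvec 0 x) (cvec y 0) : 'rV_(k + m.+1).+1)]].
Arguments Skm : clear implicits.

(** * Circle bundles over the quadric *)

Definition PQ (R : realType) (n : nat) : set 'rV[R[i]]_n.+1 :=
  [set w | exists u v : 'rV[R]_n.+1,
    [/\ w = cvec u v, enorm u = 1, enorm v = 1 & dot u v = 0]].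
Arguments PQ : clear implicits.

Lemma PQ_quadric (R : realType) (n : nat) (w : 'rV[R[i]]_n.+1) :
  PQ R n w -> quadric R n (hcoord w).
Proof.
move=> [u [v [-> u1 v1 uv]]]; exists (cvec u v) => //; split.
  exact: cvec_neq0.
by rewrite dot_cvec -!enorm_sqr u1 v1 uv subrr mul0rn.
Qed.

Lemma Skm_quadric (R : realType) (k m : nat) :
  Skm R k m `<=` quadric R (k + m.+1).
Proof.
move=> _ [x [y [x1 y1 ->]]].
have -> : row_mx (cvec 0 x) (cvec y 0) = cvec (row_mx 0 y) (row_mx x 0).
  apply/rowP => j; rewrite [RHS]mxE.
  by case: (split_ordP j) => i ->; rewrite ?row_mxEl ?row_mxEr !mxE.
have dot0 n (v : 'rV[R]_n) : dot 0 v = 0.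
  by apply: big1 => j _; rewrite mxE mul0r.
have dotr0 n (v : 'rV[R]_n) : dot v 0 = 0.
  by apply: big1 => j _; rewrite mxE mulr0.
apply: PQ_quadric; exists (row_mx (0 : 'rV_k.+1) y), (row_mx x (0 : 'rV_m.+1)).
by split; rewrite ?/enorm ?(@dot_row_mx _ k.+1 m.+1) ?dot0 ?dotr0 ?add0r ?addr0.
Qed.

(* (e^{-it} w, zeta) ~ (w, e^{it} zeta) *)
Definition DQ_rel (R : realType) (n : nat) : rel ('rV[R[i]]_n.+1 * R[i]) :=
  fun a b => `[< exists t : R, a.1 = expi (- t) *: b.1 /\ b.2 = expi t * a.2 >].

Lemma expi0 (R : realType) : expi (0 : R) = 1.
Proof. by rewrite /expi cos0 sin0. Qed.

Lemma expiD (R : realType) (s t : R) : expi (s + t) = expi s * expi t.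
Proof.
by rewrite /expi cosD sinD; apply/eqP; rewrite eq_complex /= eqxx addrC eqxx.
Qed.

Lemma expiNK (R : realType) (t : R) : expi (- t) * expi t = 1.
Proof. by rewrite -expiD addNr expi0. Qed.

Lemma expi_neq0 (R : realType) (t : R) : expi t != 0.
Proof.
apply/eqP => E; have := expiNK t; rewrite E mulr0 => /esym/eqP.
by rewrite oner_eq0.
Qed.

Lemma conjc_expiM (R : realType) (t : R) (z : R[i]) :
  conjc (expi t * z) = expi (- t) * conjc z.
Proof. by rewrite rmorphM /expi cosN sinN. Qed.

Lemma normc_expiM (R : realType) (t : R) (z : R[i]) :
  normc (expi t * z) = normc z.
Proof. by rewrite normcM /= cos2Dsin2 sqrtr1 mul1r. Qed.

Lemma DQ_refl (R : realType) (n : nat) : reflexive (@DQ_rel R n).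
Proof.
by move=> a; apply/asboolP; exists 0; rewrite oppr0 expi0 scale1r mul1r.
Qed.

Lemma DQ_sym (R : realType) (n : nat) : symmetric (@DQ_rel R n).
Proof.
suff H (a b : 'rV[R[i]]_n.+1 * R[i]) : DQ_rel a b -> DQ_rel b a.
  by move=> a b; apply/idP/idP; exact: H.
move=> /asboolP[t [Ea Eb]]; apply/asboolP; exists (- t).
rewrite Ea Eb opprK scalerA mulrA [expi t * _]mulrC.
by rewrite expiNK scale1r mul1r.
Qed.

Lemma DQ_trans (R : realType) (n : nat) : transitive (@DQ_rel R n).
Proof.
move=> b a c /asboolP[s [Ea Eb]] /asboolP[t [Eb' Ec]].
apply/asboolP; exists (s + t).
rewrite Ea Eb' Ec Eb scalerA mulrA opprD !expiD.
by rewrite [expi t * _]mulrC.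
Qed.

Canonical DQ_equiv (R : realType) (n : nat) :=
  EquivRel (@DQ_rel R n) (@DQ_refl R n) (@DQ_sym R n) (@DQ_trans R n).

Notation DQ_quot R n := {eq_quot (DQ_equiv R n)}.

Definition DQ (R : realType) (n : nat) : set (DQ_quot R n) :=
  [set \pi_(DQ_quot R n) a |
    a in [set a | PQ R n a.1 /\ normc a.2 < Num.sqrt 2]].
Arguments DQ : clear implicits.

Definition ThetaQ_lift (R : realType) (n : nat) (a : 'rV[R[i]]_n.+1 * R[i]) :
    CP R n.+1 :=
  let: (w, zeta) := a in
  let c := 1 - normc zeta ^+ 2 / 4 in
  hcoord (row_mx (const_mx ((Num.sqrt c)%:C * zeta) : 'rV_1)
                 (c%:C *: w - (zeta ^+ 2 / 4) *: conjv w)).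

Definition ThetaQ (R : realType) (n : nat) (x : DQ_quot R n) : CP R n.+1 :=
  ThetaQ_lift (repr x).

Lemma ThetaQ_pi (R : realType) (n : nat) (a : 'rV[R[i]]_n.+1 * R[i]) :
  ThetaQ (\pi_(DQ_quot R n) a) = ThetaQ_lift a.
Proof.
rewrite /ThetaQ; set b := repr _.
have : b = a %[mod DQ_quot R n] by rewrite reprK.
case: a b => [w z] [v y] /eqmodP /asboolP[t /= [-> ->]].
rewrite normc_expiM -[LHS](@hcoord_scale _ _ (expi t)) ?expi_neq0 //.
congr hcoord; set c := 1 - _.
refine (eq_trans (@scale_row_mx _ 1 1 n.+1 (expi t) _ _) _).
congr row_mx; first by apply/rowP => j; rewrite !mxE mulrCA.
apply/rowP => j; rewrite !mxE mulrBr; congr (_ - _).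
  transitivity (expi (- t) * expi t * (c%:C * w 0 j)); first by ring.
  by rewrite expiNK mul1r.
by rewrite conjc_expiM opprK; ring.
Qed.

(* The circle bundle of radius rho over a subset S of the quadric. *)
Definition circleQ (R : realType) (n : nat) (rho : R) (S : set (CP R n)) :
    set (CP R n.+1) :=
  [set ThetaQ x | x in DQ R n `&`
     [set \pi_(DQ_quot R n) a |
       a in [set a | [/\ PQ R n a.1, S (hcoord a.1) & normc a.2 = rho]]]].

Notation PP_quot R n := (pm_quot 'rV[R[i]]_n.+1).

Definition PP (R : realType) (n : nat) : set (PP_quot R n) :=
  [set \pi_(PP_quot R n) w | w in PQ R n].
Arguments PP : clear implicits.

(* ([e^{it/2} w], e^{it} zeta) ~ ([w], zeta) *)
Definition DP_rel (R : realType) (n : nat) : rel (PP_quot R n * R[i]) :=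
  fun a b => `[< exists (t : R) (w : 'rV[R[i]]_n.+1),
    [/\ b.1 = \pi_(PP_quot R n) w,
        a.1 = \pi_(PP_quot R n) (expi (t / 2) *: w) &
        a.2 = expi t * b.2] >].

Lemma pm_quot_scale (R : realType) (n : nat) (c : R[i]) (v w : 'rV[R[i]]_n) :
  v = w %[mod pm_quot 'rV[R[i]]_n] ->
  c *: v = c *: w %[mod pm_quot 'rV[R[i]]_n].
Proof.
move=> /eqmodP /orP[] /eqP -> //; apply/eqmodP.
by rewrite /= /pm_rel scalerN eqxx orbT.
Qed.

Lemma DP_refl (R : realType) (n : nat) : reflexive (@DP_rel R n).
Proof.
move=> a; apply/asboolP; exists 0, (repr a.1).
by rewrite mul0r expi0 scale1r mul1r reprK.
Qed.

Lemma DP_sym (R : realType) (n : nat) : symmetric (@DP_rel R n).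
Proof.
suff H (a b : PP_quot R n * R[i]) : DP_rel a b -> DP_rel b a.
  by move=> a b; apply/idP/idP; exact: H.
move=> /asboolP[t [w [E1 E2 E3]]]; apply/asboolP.
exists (- t), (expi (t / 2) *: w).
by rewrite mulNr scalerA E3 mulrA !expiNK scale1r mul1r.
Qed.

Lemma DP_trans (R : realType) (n : nat) : transitive (@DP_rel R n).
Proof.
move=> b a c /asboolP[s [v [E1 E2 E3]]] /asboolP[t [w [F1 F2 F3]]].
apply/asboolP; exists (s + t), w; split=> //; last by rewrite E3 F3 mulrA expiD.
rewrite E2 mulrDl expiD -scalerA; apply: pm_quot_scale.
by rewrite -E1 -F2.
Qed.

Canonical DP_equiv (R : realType) (n : nat) :=
  EquivRel (@DP_rel R n) (@DP_refl R n) (@DP_sym R n) (@DP_trans R n).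

Notation DP_quot R n := {eq_quot (DP_equiv R n)}.

Definition DP (R : realType) (n : nat) : set (DP_quot R n) :=
  [set \pi_(DP_quot R n) a | a in [set a | PP R n a.1 /\ normc a.2 < 1]].
Arguments DP : clear implicits.

Definition ThetaP_lift (R : realType) (n : nat) (w : 'rV[R[i]]_n.+1)
    (zeta : R[i]) : CP R n :=
  hcoord ((Num.sqrt (1 - normc zeta ^+ 2 / 2))%:C *: w
          - (zeta / (Num.sqrt 2)%:C) *: conjv w).

Definition ThetaP (R : realType) (n : nat) (x : DP_quot R n) : CP R n :=
  ThetaP_lift (repr (repr x).1) (repr x).2.

Lemma ThetaP_pi (R : realType) (n : nat) (w : 'rV[R[i]]_n.+1) (zeta : R[i]) :
  ThetaP (\pi_(DP_quot R n) (\pi_(PP_quot R n) w, zeta)) = ThetaP_lift w zeta.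
Proof.
have lift_scale t (v : 'rV[R[i]]_n.+1) z :
    ThetaP_lift (expi (t / 2) *: v) (expi t * z) = ThetaP_lift v z.
  rewrite /ThetaP_lift normc_expiM.
  rewrite -[RHS](@hcoord_scale _ _ (expi (t / 2))) ?expi_neq0 //.
  congr hcoord; set c := (Num.sqrt (1 - _))%:C.
  apply/rowP => j; rewrite !mxE mulrBr conjc_expiM.
  rewrite [X in expi X * z](splitr t) expiD.
  transitivity (expi (t / 2) * (c * v 0 j)
    - (expi (- (t / 2)) * expi (t / 2)) * (expi (t / 2)
      * (z / (Num.sqrt 2)%:C * conjc (v 0 j)))); first by ring.
  by rewrite expiNK mul1r.
have lift_opp (v : 'rV[R[i]]_n.+1) z : ThetaP_lift (- v) z = ThetaP_lift v z.
  rewrite /ThetaP_lift -[RHS](@hcoord_scale _ _ (-1)) ?oppr_eq0 ?oner_eq0 //.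
  congr hcoord; apply/rowP => j; rewrite !mxE [conjc _]rmorphN.
  by ring.
rewrite /ThetaP; set b := repr (\pi_(DP_quot R n) _).
have : b = (\pi_(PP_quot R n) w, zeta) %[mod DP_quot R n] by rewrite reprK.
case: b => x y /eqmodP /asboolP[t [v /= [Ev -> ->]]].
have [->|->] := pm_repr (expi (t / 2) *: v); rewrite ?lift_opp lift_scale;
  by case/eqmodP/orP: Ev => /eqP->; rewrite ?lift_opp.
Qed.

Definition circleP (R : realType) (n : nat) (rho : R) (S : set (CP R n)) :
    set (CP R n) :=
  [set ThetaP x | x in DP R n `&`
     [set \pi_(DP_quot R n) (\pi_(PP_quot R n) a.1, a.2) |
       a in [set a | [/\ PQ R n a.1, S (hcoord a.1) & normc a.2 = rho]]]].

(* The radii are the ones for which the circle bundles are monotone Lagrangian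
   submanifolds of the quadric, respectively of projective space. *)
Definition SkmQ (R : realType) (k m : nat) : set (CP R (k + m.+1).+1) :=
  circleQ (Num.sqrt (2 / (k + m + 1)%:R)) (Skm R k m).
Arguments SkmQ : clear implicits.

Definition SkmP (R : realType) (k m : nat) : set (CP R (k + m.+1)) :=
  circleP (Num.sqrt (2 / (k + m + 2)%:R)) (Skm R k m).
Arguments SkmP : clear implicits.

(* Main.v *)
(** Both sides are unions, over (x, y) in S^k x S^m, of circles.  Up to the
    equivalence relation defining the disk bundle, a point of the circle bundle
    over S_{k,m} is (w, zeta) with w = (ix, y) and |zeta| = rho.  Its image under
    Theta is, after rescaling by a phase, of the form
    [.. : a e^{it} w - b e^{-it} (conj w)] with a, b real, and that combination is
    p + iq for p = (a - b) (- sin t x, cos t y) and q = (a + b) (cos t x, sin t y):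
    up to scaling of p and q, the parametrization of the torus P_{k,m}. *)
Require Import Defs.
From mathcomp Require Import all_boot all_order all_algebra.
From mathcomp Require Import complex generic_quotient ring lra.
From mathcomp Require Import boolp classical_sets reals trigo.

Set Implicit Arguments.
Unset Strict Implicit.
Unset Printing Implicit Defensive.

Import Order.TTheory GRing.Theory Num.Theory.
Import ComplexField.Normc.

Local Open Scope classical_set_scope.
Local Open Scope ring_scope.
Local Open Scope complex_scope.
Local Open Scope quotient_scope.

(** * Phases, homogeneous coordinates and dot products *)

Lemma complex_ext (R : realType) (z w : R[i]) :
  complex.Re z = complex.Re w -> complex.Im z = complex.Im w -> z = w.
Proof. by case: z w => a b [c d] /= -> ->. Qed.

(** The arccosine of the real part has sine [|b|]; the sign of [b] decides between [acos a] and its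
    opposite. *)
Lemma expi_surj (R : realType) (z : R[i]) :
  normc z = 1 -> exists t : R, z = expi t.
Proof.
case: z => a b /= /(congr1 (fun u => u ^+ 2)).
rewrite expr1n sqr_sqrtr ?addr_ge0 ?sqr_ge0 // => ab.
have a1 : -1 <= a <= 1 by apply/andP; split; nra.
have sb : Num.sqrt (1 - a ^+ 2) = `|b| by rewrite -sqrtr_sqr; congr Num.sqrt; lra.
have [b0|b0] := leP 0 b.
  by exists (acos a); rewrite /expi acosK ?in_itv //= sin_acos // sb ger0_norm.
exists (- acos a).
by rewrite /expi cosN sinN acosK ?in_itv //= sin_acos // sb ltr0_norm // opprK.
Qed.

Lemma polar_form (R : realType) (z : R[i]) :
  exists t : R, z = (normc z)%:C * expi t.
Proof.
have [z0|z0] := eqVneq (normc z) 0.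
  by exists 0; rewrite z0 mul0r; exact: eq0_normc.
have [|t E] := @expi_surj _ ((normc z)^-1%:C * z).
  rewrite normcM /normc /= expr0n addr0 sqrtr_sqr ger0_norm ?mulVf //.
  by rewrite invr_ge0; case: (z) => a b; exact: sqrtr_ge0.
exists t; rewrite -E mulrA -rmorphM mulfV //.
by rewrite rmorph1 mul1r.
Qed.

Lemma normc_polar (R : realType) (r t : R) :
  0 <= r -> normc (r%:C * expi t) = r.
Proof.
by move=> r0; rewrite mulrC normc_expiM /normc /= expr0n addr0 sqrtr_sqr ger0_norm.
Qed.

(** For nonzero vectors [insubd] returns the actual span, so [z] lies on the line of [w]. *)
Lemma hcoord_inj (R : realType) (N : nat) (z w : 'rV[R[i]]_N.+1) :
  z != 0 -> w != 0 -> hcoord z = hcoord w -> exists c, z = c *: w.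
Proof.
move=> z0 w0 /(congr1 val); rewrite /hcoord !val_insubd !dim_vline z0 w0 /= => E.
by apply/vlineP; rewrite -E memv_line.
Qed.

(** Serves to show that a scalar relating two vectors of equal Hermitian norm is a phase. *)
Lemma sum_normc_cvec (R : realType) (n : nat) (c : R[i]) (u v : 'rV[R]_n) :
  \sum_j normc ((c *: cvec u v) 0 j) ^+ 2
    = normc c ^+ 2 * (enorm u ^+ 2 + enorm v ^+ 2).
Proof.
rewrite !enorm_sqr /dot -big_split big_distrr /=; apply: eq_bigr => j _.
rewrite !mxE normcM exprMn; congr (_ * _) => /=.
by rewrite sqr_sqrtr ?addr_ge0 ?sqr_ge0 // !expr2.
Qed.

Lemma dot0v (K : pzRingType) (n : nat) (v : 'rV[K]_n) : dot 0 v = 0.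
Proof. by apply: big1 => j _; rewrite mxE mul0r. Qed.

Lemma dotv0 (K : pzRingType) (n : nat) (v : 'rV[K]_n) : dot v 0 = 0.
Proof. by apply: big1 => j _; rewrite mxE mulr0. Qed.

Lemma dotZZ (K : comPzRingType) (n : nat) (a b : K) (u v : 'rV[K]_n) :
  dot (a *: u) (b *: v) = a * b * dot u v.
Proof.
by rewrite /dot mulr_sumr; apply: eq_bigr => j _; rewrite !mxE mulrACA.
Qed.

(** For r = a^2 - b^2 the root of 1 - r^2 is 2ab, so the numerator of f(r) is (a - b)^2 and f(r) =
    (a + b)^-2. Since b < a, r is nonzero and the special value at 0 does not arise. *)
Lemma sqrt_fP (R : realType) (a b : R) : 0 <= b < a -> a ^+ 2 + b ^+ 2 = 1 ->
  Num.sqrt (fP (a ^+ 2 - b ^+ 2)) = (a + b)^-1.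
Proof.
move=> /andP[b0 ba] ab; have ab0 : a + b != 0 by apply/eqP; lra.
have amb : a - b != 0 by apply/eqP; lra.
have r0 : a ^+ 2 - b ^+ 2 != 0 by rewrite subr_sqr mulf_neq0.
rewrite /fP (negbTE r0).
have -> : 1 - (a ^+ 2 - b ^+ 2) ^+ 2 = (2 * a * b) ^+ 2.
  by rewrite -[X in X - _](expr1n _ 2) -[in X in X - _]ab; ring.
rewrite sqrtr_sqr ger0_norm; last by rewrite !mulr_ge0 //; lra.
rewrite (_ : _ / _ = ((a + b)^-1) ^+ 2); last first.
  by rewrite -[X in X - _]ab; field; rewrite r0 ab0.
by rewrite sqrtr_sqr ger0_norm // invr_ge0; lra.
Qed.

Local Arguments ThetaQ_lift : simpl never.
Local Arguments normc : simpl never.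

(** * Circle bundles over S_{k,m} parametrized by t, x and y *)

Section CliffordTorus.
Variables (R : realType) (k m : nat).
Implicit Types (x : 'rV[R]_k.+1) (y : 'rV[R]_m.+1).

Definition Skm_lift x y : 'rV[R[i]]_(k + m.+1).+1 :=
  row_mx (cvec 0 x) (cvec y 0).

Lemma Skm_liftE x y :
  Skm_lift x y = cvec (row_mx 0 y : 'rV_(k.+1 + m.+1)) (row_mx x 0).
Proof.
apply/rowP => j; rewrite /Skm_lift [RHS]mxE.
by case: (@split_ordP k.+1 m.+1 j) => i ->; rewrite ?(@row_mxEl _ 1 k.+1 m.+1) ?(@row_mxEr _ 1 k.+1 m.+1) !mxE.
Qed.

Lemma Skm_lift_PQ x y :
  unit_sphere R k x -> unit_sphere R m y -> PQ R (k + m.+1) (Skm_lift x y).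
Proof.
move=> x1 y1; exists (row_mx 0 y : 'rV_(k.+1 + m.+1)), (row_mx x 0 : 'rV_(k.+1 + m.+1)).
rewrite -Skm_liftE.
by split; rewrite ?/enorm ?(@dot_row_mx _ k.+1 m.+1) ?dot0v ?dotv0 ?add0r ?addr0.
Qed.

(** Both [w] and [Skm_lift x y] have squared Hermitian norm 2, so their ratio has modulus 1. *)
Lemma Skm_hcoordP (w : 'rV[R[i]]_(k + m.+1).+1) :
  PQ R (k + m.+1) w -> Skm R k m (hcoord w) ->
  exists t x y, [/\ unit_sphere R k x, unit_sphere R m y &
                    w = expi t *: Skm_lift x y].
Proof.
move=> [u [v [-> u1 v1 _]]] [x [y [x1 y1]]] /=.
have [u' [v' [E u'1 v'1 _]]] := Skm_lift_PQ x1 y1.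
rewrite -/(Skm_lift x y) E => /hcoord_inj[||c Ec]; try exact: cvec_neq0.
have [|t Et] := @expi_surj _ c; last by exists t, x, y; rewrite -Et E.
have := sum_normc_cvec 1 u v; rewrite scale1r Ec sum_normc_cvec u1 v1 u'1 v'1.
rewrite (_ : normc 1 = 1) => [H|]; last by rewrite /normc /= expr0n addr0 expr1n sqrtr1.
have c0 : 0 <= normc c by case: (c) => a b; exact: sqrtr_ge0.
by apply/eqP; rewrite -(@eqrXn2 _ 2) //; apply/eqP; lra.
Qed.

Lemma circleQ_Skm (rho : R) : 0 <= rho < Num.sqrt 2 ->
  circleQ rho (Skm R k m) =
  [set z | exists t x y, [/\ unit_sphere R k x, unit_sphere R m y &
     z = ThetaQ_lift (Skm_lift x y, rho%:C * expi t)]].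
Proof.
move=> /andP[rho0 rho2]; apply/seteqP; split => z.
  move=> [_ [_ [[w zeta] /= [wPQ wS zr] <-]] <-].
  have [s [x [y [x1 y1 Ew]]]] := Skm_hcoordP wPQ wS.
  (* The phase of [w] over (ix, y) is moved into the fibre coordinate by the relation defining the
     disk bundle. *)
  have [t Et] := polar_form (expi (- s) * zeta).
  exists t, x, y; split; [exact: x1 | exact: y1 |].
  move: Et; rewrite normc_expiM zr => <-; rewrite -!ThetaQ_pi.
  congr ThetaQ; apply/eqmodP/asboolP; exists (- s) => /=.
  by rewrite opprK.
move=> [t [x [y [x1 y1 ->]]]].
have wPQ := Skm_lift_PQ x1 y1; have nr := normc_polar t rho0.
exists (\pi_(DQ_quot R (k + m.+1)) (Skm_lift x y, rho%:C * expi t)); last exact: ThetaQ_pi.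
split; exists (Skm_lift x y, rho%:C * expi t) => //=; rewrite nr //.
by split => //; exists x, y.
Qed.

Lemma circleP_Skm (rho : R) : 0 <= rho < 1 ->
  circleP rho (Skm R k m) =
  [set z | exists t x y, [/\ unit_sphere R k x, unit_sphere R m y &
     z = ThetaP_lift (Skm_lift x y) (rho%:C * expi t)]].
Proof.
move=> /andP[rho0 rho1]; apply/seteqP; split => z.
  move=> [_ [_ [[w zeta] /= [wPQ wS zr] <-]] <-].
  have [s [x [y [x1 y1 Ew]]]] := Skm_hcoordP wPQ wS.
  (* The phase is doubled: here a rotation of [w] by s corresponds to a rotation of [zeta] by 2s. *)
  have [t Et] := polar_form (expi (- (s + s)) * zeta).
  exists t, x, y; split; [exact: x1 | exact: y1 |].
  move: Et; rewrite normc_expiM zr => <-; rewrite -!ThetaP_pi.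
  congr ThetaP; apply/eqmodP/asboolP; exists (s + s), (Skm_lift x y) => /=.
  split=> //; first by rewrite Ew; congr (\pi_(PP_quot R (k + m.+1)) (expi _ *: _)); lra.
  by rewrite mulrA [expi _ * expi _]mulrC expiNK mul1r.
move=> [t [x [y [x1 y1 ->]]]].
have wPQ := Skm_lift_PQ x1 y1; have nr := normc_polar t rho0.
exists (\pi_(DP_quot R (k + m.+1)) (\pi_(PP_quot R (k + m.+1)) (Skm_lift x y), rho%:C * expi t)); last exact: ThetaP_pi.
split.
  exists (\pi_(PP_quot R (k + m.+1)) (Skm_lift x y), rho%:C * expi t) => //=; rewrite nr.
  by split => //; exists (Skm_lift x y).
exists (Skm_lift x y, rho%:C * expi t) => //=; rewrite nr.
by split => //; exists x, y.
Qed.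

(** * Torus points and their images under the two embeddings *)

Definition torus_pt (r t : R) x y : phase R (k + m.+1) :=
  (row_mx (- (r * sin t) *: x) ((r * cos t) *: y),
   row_mx (cos t *: x) (sin t *: y)).

Lemma enorm_torus_pt (r t : R) x y : 0 <= r ->
  unit_sphere R k x -> unit_sphere R m y -> enorm (torus_pt r t x y).1 = r.
Proof.
move=> r0 x1 y1; rewrite /enorm (@dot_row_mx _ k.+1 m.+1) !dotZZ -!enorm_sqr x1 y1.
rewrite -[RHS]ger0_norm // -sqrtr_sqr; congr Num.sqrt.
have := cos2Dsin2 t => cs.
transitivity (r ^+ 2 * (cos t ^+ 2 + sin t ^+ 2)); first by ring.
by rewrite cs mulr1.
Qed.

Lemma torus_pt_D1S (r t : R) x y : 0 <= r < 1 ->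
  unit_sphere R k x -> unit_sphere R m y -> D1S R (k + m.+1) (torus_pt r t x y).
Proof.
move=> /andP[r0 r1] x1 y1; split; last by rewrite enorm_torus_pt.
split => /=; rewrite ?/enorm (@dot_row_mx _ k.+1 m.+1) !dotZZ -!enorm_sqr x1 y1.
  by ring.
by rewrite expr1n !mulr1 -!expr2 cos2Dsin2 sqrtr1.
Qed.

(** Conjugation sends (ix, y) to (-ix, y), so x is multiplied by i(a e^{it} + b e^{-it}) and y by a
    e^{it} - b e^{-it}. *)
Lemma Skm_lift_comb (a b t : R) x y :
  (a%:C * expi t) *: Skm_lift x y - (b%:C * expi (- t)) *: conjv (Skm_lift x y)
  = cvec ((a - b) *: (torus_pt 1 t x y).1) ((a + b) *: (torus_pt 1 t x y).2).
Proof.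
rewrite /torus_pt /= !(@scale_row_mx _ 1 k.+1 m.+1) /expi cosN sinN /Skm_lift.
apply/rowP => j; rewrite ![in LHS]mxE [RHS]mxE.
by case: (@split_ordP k.+1 m.+1 j) => i ->;
  rewrite ?(@row_mxEl _ 1 k.+1 m.+1) ?(@row_mxEr _ 1 k.+1 m.+1) !mxE;
  apply: complex_ext => /=; ring.
Qed.

(** The coefficients c = 1 - rho^2/4 = (1 + r)/2 and b = rho^2/4 = (1 - r)/2 satisfy c - b = r and c
    + b = 1, the norms of p and q. The first coordinates agree because c rho^2 = 1 - r^2. *)
Lemma Psi_torus_pt (r rho t : R) x y : 0 <= r < 1 -> 0 <= rho ->
  rho ^+ 2 = 2 * (1 - r) -> unit_sphere R k x -> unit_sphere R m y ->
  Psi (torus_pt r t x y) = ThetaQ_lift (Skm_lift x y, rho%:C * expi (- t)).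
Proof.
move=> /andP[r0 r1] rho0 Er x1 y1.
rewrite /Psi /ThetaQ_lift enorm_torus_pt // normc_polar //.
set c := 1 - rho ^+ 2 / 4; set b := (1 - r) / 2.
have cD : c = (1 + r) / 2 by rewrite /c Er; field.
have Eb : rho ^+ 2 = 4 * b by rewrite Er /b; field.
rewrite -[LHS](@hcoord_scale _ _ (expi (- t))) ?expi_neq0 //; congr hcoord.
refine (eq_trans (@scale_row_mx _ 1 1 _ (expi (- t)) _ _) _).
congr row_mx.
  apply/rowP => j; rewrite !mxE mulrC mulrA -rmorphM; congr ((_)%:C * _).
  rewrite -[in RHS](ger0_norm rho0) -sqrtr_sqr -sqrtrM; last by rewrite cD; lra.
  by congr Num.sqrt; rewrite Er cD; field.
transitivity (expi (- t) *: ((c%:C * expi t) *: Skm_lift x y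
    - (b%:C * expi (- t)) *: conjv (Skm_lift x y))).
  rewrite Skm_lift_comb; congr (_ *: cvec _ _).
    rewrite (_ : c - b = r); last by rewrite cD /b; field.
    rewrite /torus_pt /= (@scale_row_mx _ 1 k.+1 m.+1) !scalerA.
    by rewrite !mul1r mulrN.
  by rewrite (_ : c + b = 1) ?scale1r // cD /b; field.
rewrite scalerBr !scalerA; congr (_ *: _ - _ *: _).
  by rewrite mulrCA expiNK mulr1.
have -> : (rho%:C * expi (- t)) ^+ 2 = (4 * b)%:C * (expi (- t) * expi (- t)).
  by rewrite -Eb rmorphXn; ring.
by rewrite mulr_natl [(b *+ 4)%:C]rmorphMn; field.
Qed.

(** Scaling p and q by (a + b)^-1 and a + b gives them norms a - b and a + b, as in [Skm_lift_comb].
    On the other side |zeta|^2/2 = b^2, which makes the coefficient of w equal to a. *)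
Lemma PsiP_torus_pt (a b t : R) x y : 0 <= b < a -> a ^+ 2 + b ^+ 2 = 1 ->
  unit_sphere R k x -> unit_sphere R m y ->
  PsiP_lift (torus_pt (a ^+ 2 - b ^+ 2) t x y) =
  ThetaP_lift (Skm_lift x y) ((Num.sqrt 2 * b)%:C * expi (- (t + t))).
Proof.
move=> bltDa ab x1 y1; have /andP[b0 ba] := bltDa.
have ab0 : a + b != 0 by apply/eqP; lra.
rewrite /PsiP_lift /ThetaP_lift enorm_torus_pt //; last by nra.
rewrite sqrt_fP // normc_polar ?mulr_ge0 ?sqrtr_ge0 //.
have s20 : (Num.sqrt 2 : R) != 0 by rewrite sqrtr_eq0 -ltNge ltr0n.
rewrite exprMn sqr_sqrtr ?ler0n // [2 * _]mulrC mulfK ?pnatr_eq0 //.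
have -> : 1 - b ^+ 2 = a ^+ 2 by rewrite -ab addrK.
rewrite sqrtr_sqr ger0_norm; last by lra.
rewrite -[LHS](@hcoord_scale _ _ (expi (- t))) ?expi_neq0 //; congr hcoord.
transitivity (expi (- t) *: ((a%:C * expi t) *: Skm_lift x y
    - (b%:C * expi (- t)) *: conjv (Skm_lift x y))).
  rewrite Skm_lift_comb invrK; congr (_ *: cvec _ _).
  rewrite /torus_pt /= !(@scale_row_mx _ 1 k.+1 m.+1) !scalerA.
  by congr (@row_mx _ 1 k.+1 m.+1 _ _); congr (_ *: _); field.
rewrite scalerBr !scalerA; congr (_ *: _ - _ *: _).
  by rewrite mulrCA expiNK mulr1.
rewrite opprD expiD.
have -> : (Num.sqrt 2 * b)%:C = (Num.sqrt 2)%:C * b%:C by exact: rmorphM.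
have : (Num.sqrt 2 : R)%:C != 0 by rewrite fmorph_eq0.
by move: (expi _) b%:C (Num.sqrt 2)%:C => E B S S0; field.
Qed.

(** * Equality of tori and circle bundles for matching radii *)

Lemma D1S_torusS (r : R) : 0 <= r < 1 ->
  D1S R (k + m.+1) `&` torusS R k m r = torusS R k m r.
Proof.
move=> r01; apply/seteqP; split => [_ []|_ [t [x [y [x1 y1 ->]]]]] //.
by split; [exact: torus_pt_D1S | exists t, x, y].
Qed.

Lemma Psi_torusS (r rho : R) : 0 <= r < 1 -> 0 <= rho < Num.sqrt 2 ->
  rho ^+ 2 = 2 * (1 - r) ->
  [set Psi pq | pq in torusS R k m r] = circleQ rho (Skm R k m).
Proof.
move=> r01 rho02 Er; have /andP[rho0 _] := rho02.
rewrite circleQ_Skm //; apply/seteqP; split => z.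
  move=> [_ [t [x [y [x1 y1 ->]]]] <-]; exists (- t), x, y; split; [exact: x1 | exact: y1 |].
  exact: Psi_torus_pt.
move=> [t [x [y [x1 y1 ->]]]]; exists (torus_pt r (- t) x y).
  by exists (- t), x, y.
by rewrite (Psi_torus_pt _ r01 rho0 Er x1 y1) opprK.
Qed.

Lemma PsiP_torusS (r rho : R) : 0 < r < 1 -> 0 <= rho < 1 ->
  rho ^+ 2 = 1 - r ->
  [set PsiP_lift pq | pq in torusS R k m r] = circleP rho (Skm R k m).
Proof.
move=> /andP[r0 r1] rho01 Er; have /andP[rho0 _] := rho01.
(* The solution of a^2 + b^2 = 1 and a^2 - b^2 = r; positivity of r gives b < a. *)
pose a := Num.sqrt ((1 + r) / 2); pose b := Num.sqrt ((1 - r) / 2).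
have a2 : a ^+ 2 = (1 + r) / 2 by rewrite sqr_sqrtr //; lra.
have b2 : b ^+ 2 = (1 - r) / 2 by rewrite sqr_sqrtr //; lra.
have ba : 0 <= b < a by rewrite sqrtr_ge0 ltr_sqrt; lra.
have ab : a ^+ 2 + b ^+ 2 = 1 by rewrite a2 b2; field.
have Erho : rho = Num.sqrt 2 * b.
  rewrite -sqrtrM // -[LHS](ger0_norm rho0) -sqrtr_sqr Er; congr Num.sqrt.
  by field.
have Erab : r = a ^+ 2 - b ^+ 2 by rewrite a2 b2; field.
rewrite circleP_Skm // Erho Erab.
apply/seteqP; split => z.
  move=> [_ [t [x [y [x1 y1 ->]]]] <-]; exists (- (t + t)), x, y; split; [exact: x1 | exact: y1 |].
  exact: PsiP_torus_pt.
move=> [t [x [y [x1 y1 ->]]]].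
(* The angle is halved because torus angle s corresponds to fibre angle -2s. *)
exists (torus_pt (a ^+ 2 - b ^+ 2) (- (t / 2)) x y).
  by exists (- (t / 2)), x, y.
by rewrite (PsiP_torus_pt _ ba ab x1 y1) -opprD opprK -splitr.
Qed.

End CliffordTorus.

Theorem theorem1p3 (R : realType) (k m : nat) (hkm : (k <= m)%N)
    (hm : (1 <= m)%N) :
  LQ R k m = SkmQ R k m /\ LP R k m = SkmP R k m.
Proof.
split.
  (* With N = k + m + 1 and r = 1 - 1/N, the squared radius 2/N is 2(1 - r); N >= 2 keeps it below
     2. *)
  have n2 : 2 <= (k + m + 1)%:R :> R by rewrite ler_nat addn1 ltnS ltn_addl.
  rewrite /LQ /SkmQ; move: ((k + m + 1)%:R : R) n2 => N N2.
  have N0 : 0 < N by lra.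
  have Nlt : 0 < N^-1 <= 2^-1 by rewrite invr_gt0 N0 lef_pV2 ?posrE.
  have /andP[Ni0 Ni2] := Nlt.
  rewrite D1S_torusS; last by apply/andP; lra.
  apply: Psi_torusS; first by apply/andP; lra.
    by rewrite sqrtr_ge0 ltr_sqrt; lra.
  by rewrite sqr_sqrtr; lra.
(* Now N = k + m + 2, r = 1 - 2/N and the squared radius 2/N is 1 - r. The bound N >= 3, from m >=
   1, makes r positive and the radius less than 1. *)
have n3 : 3 <= (k + m + 2)%:R :> R by rewrite ler_nat addn2 !ltnS ltn_addl.
rewrite /LP /SkmP; move: ((k + m + 2)%:R : R) n3 => N N3.
have N0 : 0 < N by lra.
have Nlt : 0 < N^-1 <= 3^-1 by rewrite invr_gt0 N0 lef_pV2 ?posrE.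
have /andP[Ni0 Ni3] := Nlt.
rewrite -(@PsiP_torusS _ _ _ (1 - 2 / N)); first last.
- by rewrite sqr_sqrtr; lra.
- by rewrite sqrtr_ge0 -[ltRHS]sqrtr1 ltr_sqrt; lra.
- by apply/andP; lra.
apply/seteqP; split => z.
  by move=> [_ [_ [pq pqT <-]] <-]; exists pq => //; rewrite PsiP_pi.
move=> [pq pqT <-]; exists (\pi_(pm_quot (phase R (k + m.+1))) pq); last exact: PsiP_pi.
split; exists pq => //.
by have := pqT; rewrite -D1S_torusS => [[]|]; last by apply/andP; lra.
Qed.
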